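(* Let $Y=(Y_1,\dots,Y_k)^T$ be a random vector with density $f(y;\theta)$ on $\mathcal{Y}\subset\mathbb{R}^k$, $\theta\in\Theta\subset\mathbb{R}^d$, and let $R=(R_1,\dots,R_k)^T$ be the vector of observation indicators, with values in $\mathcal{R}=\{0,1\}^k$ ($R_i=1$ if $Y_i$ is observed, $R_i=0$ if $Y_i$ is missing). Suppose that the joint distribution of $(Y,R)$ is given by the selection model $$f(y,r;\theta,\psi)=f(y;\theta)\,f(r\mid y;\psi),\qquad (\theta,\psi)\in\Theta\times\Psi,$$ with distinct parameters $\theta$ and $\psi$. Assume that $\{f(y;\theta):\theta\in\Theta\}$ is a complete family. Then the missing data mechanism $f(r\mid y;\psi)$ is likelihood ignorable (LIG) if and only if it is missing at random (MAR).
   Context: Distinct parameters: the joint parameter space of $(\theta,\psi)$ is the product $\Theta\times\Psi$. The conditional distribution $f(r\mid y;\psi)$ of $R$ given $Y=y$ is called the missing data mechanism (MDM). Notation: for $r\in\mathcal{R}$, $y^{(r)}=(y_i: r_i=1)^T$ is the observed subvector of $y$ and $y^{(\mathbb{1}-r)}=(y_i:r_i=0)^T$ is the missing subvector, where $\mathbb{1}=(1,\dots,1)^T\in\mathbb{R}^k$. $f(y^{(\mathbb{1}-r)}\mid y^{(r)};\theta)$ is the conditional density of the missing subvector given the observed subvector under $f(y;\theta)$. (If $r=\mathbb{1}$ there is nothing to integrate, and the integral below is just $f(r\mid y;\psi)$; if $r=0$ the conditional density is $f(y;\theta)$ itself.) Integrals over $y^{(\mathbb{1}-r)}$ are over the whole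 range of the missing variables. Complete family: $\{f(y;\theta):\theta\in\Theta\}$ on $\mathcal{Y}$ is complete if $\int t(y)f(y;\theta)\,dy=0$ for all $\theta\in\Theta$ implies $t(y)=0$ for almost all $y\in\mathcal{Y}$. MAR: the MDM is missing at random if for every $\psi\in\Psi$ and $r\in\mathcal{R}$ there is a function $h_r(\cdot;\psi)$ from $\mathbb{R}^{(\mathbb{1}^Tr)}$ to $[0,1]$ such that $f(r\mid y;\psi)=h_r(y^{(r)};\psi)$ for almost all $y\in\mathcal{Y}$; that is, $f(r\mid y;\psi)$ depends on $y$ only through the observed subvector $y^{(r)}$. LIG: the MDM is likelihood ignorable if the integral $$\int f(y^{(\mathbb{1}-r)}\mid y^{(r)};\theta)\,f(r\mid y;\psi)\,dy^{(\mathbb{1}-r)}$$ is free of $\theta$ for almost all realizations $(y,r)\in\mathcal{Y}\times\mathcal{R}$ and for all $(\theta,\psi)\in\Theta\times\Psi$. *)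

(* Defs.v *)
From HB Require Import structures.
From mathcomp Require Import all_boot all_order all_algebra.
From mathcomp Require Import all_classical all_reals all_analysis.

Set Implicit Arguments.
Unset Strict Implicit.
Unset Printing Implicit Defensive.

Import Order.TTheory GRing.Theory Num.Theory.
Import numFieldNormedType.Exports.

Local Open Scope classical_set_scope.
Local Open Scope ring_scope.

Section lebesgue_cons.
Context {R : realType} {n : nat}.
Variable mu : {sigma_finite_measure set (n.-tuple R) -> \bar R}.

Definition tcons (p : measurableTypeR R * n.-tuple R) : n.+1.-tuple R :=
  [tuple of p.1 :: p.2].

Lemma measurable_tcons : measurable_fun setT tcons.
Proof. exact: (@measurable_cons _ _ _ _ fst n snd measurable_fst measurable_snd). Qed.

Definition tuncons (t : n.+1.-tuple R) : measurableTypeR R * n.-tuple R :=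
  (thead t, [tuple of behead t]).

Lemma measurable_tuncons : measurable_fun setT tuncons.
Proof.
apply/measurable_fun_pairP; split.
  exact: (@measurable_tnth _ _ n.+1 ord0).
exact: measurable_behead.
Qed.

Lemma tconsK : cancel tcons tuncons.
Proof. by move=> [x t]; congr pair; apply/val_inj. Qed.

Lemma tunconsK : cancel tuncons tcons.
Proof. by move=> t; rewrite [in RHS](tuple_eta t); apply/val_inj. Qed.

Definition lebesgue_cons : set (n.+1.-tuple R) -> \bar R :=
  pushforward (@lebesgue_measure R \x mu)%E tcons.

Let lebesgue_cons0 : lebesgue_cons set0 = 0%E.
Proof. by rewrite /lebesgue_cons /pushforward preimage_set0 measure0. Qed.

Let lebesgue_cons_ge0 A : (0 <= lebesgue_cons A)%E.
Proof. exact: (measure_ge0 (@lebesgue_measure R \x mu)%E). Qed.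

Let lebesgue_cons_sigma_additive : semi_sigma_additive lebesgue_cons.
Proof.
move=> F mF tF mUF; rewrite /lebesgue_cons /pushforward preimage_bigcup.
have mpre A : measurable A -> measurable (tcons @^-1` A).
  by move=> mA; rewrite -[X in measurable X]setTI; exact: measurable_tcons.
apply: measure_semi_sigma_additive => [k||]; first exact: mpre.
- apply/trivIsetP => /= i j _ _ ij; rewrite -preimage_setI.
  by move/trivIsetP : tF => /(_ _ _ _ _ ij) ->//; rewrite preimage_set0.
- by rewrite -preimage_bigcup; exact: mpre.
Qed.

HB.instance Definition _ := isMeasure.Build _ _ _ lebesgue_cons
  lebesgue_cons0 lebesgue_cons_ge0 lebesgue_cons_sigma_additive.

Let lebesgue_cons_sigma_finite : sigma_finite setT lebesgue_cons.
Proof.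
have /sigma_finiteP[F [TF ndF Foo]] := sigma_finiteT (@lebesgue_measure R).
have /sigma_finiteP[G [TG ndG Goo]] := sigma_finiteT mu.
exists (fun k => tuncons @^-1` (F k `*` G k)).
  rewrite -preimage_bigcup (_ : \bigcup_k _ = setT) ?preimage_setT//.
  rewrite -subTset => -[x t] _.
  have [a _ Fx] : (\bigcup_k F k) x by rewrite -TF.
  have [b _ Gt] : (\bigcup_k G k) t by rewrite -TG.
  exists (maxn a b) => //; split => /=.
    by move: x Fx; exact/subsetPset/ndF/leq_maxl.
  by move: t Gt; exact/subsetPset/ndG/leq_maxr.
move=> k; have [mF Fk] := Foo k; have [mG Gk] := Goo k; split.
  rewrite -[X in measurable X]setTI; apply: measurable_tuncons => //.
  exact: measurableX.
rewrite /lebesgue_cons /pushforward -comp_preimage.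
rewrite (_ : tuncons \o tcons = id); last first.
  by apply/funext => p /=; exact: tconsK.
by rewrite preimage_id product_measure1E// lte_mul_pinfty// ge0_fin_numE.
Qed.

HB.instance Definition _ := @Measure_isSigmaFinite.Build _ _ _
  lebesgue_cons lebesgue_cons_sigma_finite.

End lebesgue_cons.

(* Lebesgue measure on R^n, as an iterated product measure; R^0 is a point of
   mass 1, so that an integral over zero variables is evaluation. *)
Fixpoint lebesgue_tuple (R : realType) (n : nat) :
    {sigma_finite_measure set (n.-tuple R) -> \bar R} :=
  if n is m.+1 then lebesgue_cons (lebesgue_tuple R m) else \d_ [tuple].

Lemma lebesgue_tuple_box (R : realType) (n : nat) (A : 'I_n -> set R) :
  (forall i, measurable (A i)) ->
  lebesgue_tuple R n [set t | forall i, A i (tnth t i)] =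
  (\prod_(i < n) lebesgue_measure (A i))%E.
Proof.
elim: n A => [|n IHn] A mA.
  by rewrite big_ord0 /= diracE mem_set// => -[].
have mB : measurable [set t : n.-tuple R | forall i, A (lift ord0 i) (tnth t i)].
  rewrite (_ : mkset _ = \bigcap_(i in [set: 'I_n])
      ((@tnth n R ^~ i) @^-1` A (lift ord0 i))).
    apply: fin_bigcap_measurable; first exact: finite_finset.
    move=> i _.
    rewrite -[X in measurable X]setTI; exact: measurable_tnth.
  apply/seteqP; split => t At.
    by move=> i _; exact: At.
  by move=> i; exact: (At i).
rewrite big_ord_recl -IHn//= /lebesgue_cons /pushforward.
rewrite -product_measure1E//; last exact: (mA ord0).
congr ((_ \x _)%E _).
apply/seteqP; split => -[x t] /=.
  move=> At; split => [|i]; first exact: (At ord0).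
  by have := At (lift ord0 i); rewrite tnthS.
move=> [Ax At] i; have [->//|i0] := eqVneq i ord0.
by have [j ->|] := unliftP ord0 i; [rewrite tnthS|move/eqP: i0].
Qed.

Section subvector.
Context {k : nat}.
Implicit Types r : k.-tuple bool.

Definition cpl r : k.-tuple bool := [tuple of map negb r].

Lemma subvec_size (T : Type) r (y : k.-tuple T) :
  size (mask r y) == count id r.
Proof. by rewrite size_mask// !size_tuple. Qed.

Definition subvec (T : Type) r (y : k.-tuple T) : (count id r).-tuple T :=
  Tuple (subvec_size r y).

(* The vector y with y^(r) = u and y^(1-r) = z. *)
Definition combine (R : nmodType) r (u : (count id r).-tuple R)
    (z : (count id (cpl r)).-tuple R) : k.-tuple R :=
  [tuple if tnth r i then nth 0 u (count id (take i r))
         else nth 0 z (count id (take i (cpl r))) | i < k].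

Lemma nth_mask_count (T : Type) (x0 : T) (m : bitseq) (s : seq T) (i : nat) :
  nth false m i -> nth x0 (mask m s) (count id (take i m)) = nth x0 s i.
Proof.
by elim: m s i => [|[] m IHm] [|x s] [|i] //= /IHm {}IHm; rewrite ?nth_nil.
Qed.

Lemma subvecK (R : nmodType) r (y : k.-tuple R) :
  combine (subvec r y) (subvec (cpl r) y) = y.
Proof.
apply/eq_from_tnth => i; rewrite tnth_mktuple.
have ltir : (i < size r)%N by rewrite size_tuple.
rewrite (tnth_nth false) [RHS](tnth_nth 0); case: ifPn => ri.
  exact: nth_mask_count.
by rewrite nth_mask_count//= (nth_map false).
Qed.

Lemma count_take_surj (m : bitseq) (j : nat) : (j < count id m)%N ->
  exists i, [/\ (i < size m)%N, nth false m i & count id (take i m) = j].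
Proof.
elim: m j => [|[] m IHm] [|j] //=.
- by move=> _; exists 0%N; rewrite take0.
- rewrite ltnS => /IHm[i [ltim mi <-]]; exists i.+1; split=> //.
- by move=> /IHm[i [ltim mi ci]]; exists i.+1; split=> //=; rewrite ci.
- by move=> /IHm[i [ltim mi ci]]; exists i.+1; split=> //=; rewrite ci.
Qed.

Lemma combineKl (R : nmodType) r (u : (count id r).-tuple R) z :
  subvec r (combine u z) = u.
Proof.
apply/val_inj/(@eq_from_nth _ 0) => [|j]; first by rewrite !size_tuple.
rewrite size_tuple => /count_take_surj[i [+ ri <-]].
rewrite size_tuple => ltik; rewrite nth_mask_count//.
rewrite -(tnth_nth _ _ (Ordinal ltik)) tnth_mktuple.
by rewrite (tnth_nth false) /= ri.
Qed.

Lemma combineKr (R : nmodType) r u (z : (count id (cpl r)).-tuple R) :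
  subvec (cpl r) (combine u z) = z.
Proof.
apply/val_inj/(@eq_from_nth _ 0) => [|j]; first by rewrite !size_tuple.
rewrite size_tuple => /count_take_surj[i [+ ri <-]].
rewrite size_tuple => ltik; rewrite nth_mask_count//.
rewrite -(tnth_nth _ _ (Ordinal ltik)) tnth_mktuple.
rewrite (tnth_nth false) /=; move: ri.
by rewrite (nth_map false) ?size_tuple// => /negbTE ->.
Qed.

End subvector.

Section missing_data.
Context {R : realType} {k : nat}.
Implicit Types (Y : set (k.-tuple R)) (p : k.-tuple R -> R)
  (r : k.-tuple bool).

Definition is_density Y p :=
  [/\ measurable_fun Y p, forall y, Y y -> 0 <= p y &
      (\int[lebesgue_tuple R k]_(y in Y) (p y)%:E = 1)%E].

(* g r y is the conditional probability f(r | y). *)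
Definition is_mechanism Y (g : k.-tuple bool -> k.-tuple R -> R) :=
  [/\ forall r, measurable_fun Y (g r),
      forall r y, Y y -> 0 <= g r y &
      forall y, Y y -> \sum_r g r y = 1].

(* Density with respect to the product of Lebesgue measure on Y and counting
   measure on {0,1}^k. *)
Definition has_joint_density d (Omega : measurableType d)
    (P : probability Omega R) (Yv : {mfun Omega >-> k.-tuple R})
    (Rv : {mfun Omega >-> k.-tuple bool}) Y (q : k.-tuple R -> k.-tuple bool -> R) :=
  forall (A : set (k.-tuple R)) r, measurable A ->
    P (Yv @^-1` A `&` Rv @^-1` [set r]) =
    (\int[lebesgue_tuple R k]_(y in Y `&` A) (q y r)%:E)%E.

Definition complete_family (Theta_t : Type) (Theta : set Theta_t) Y
    (f : Theta_t -> k.-tuple R -> R) :=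
  forall t : k.-tuple R -> R, measurable_fun Y t ->
    (forall th, Theta th ->
      (lebesgue_tuple R k).-integrable Y (fun y => (t y * f th y)%:E) /\
      (\int[lebesgue_tuple R k]_(y in Y) (t y * f th y)%:E = 0)%E) ->
    {ae lebesgue_tuple R k, forall y, Y y -> t y = 0}.

Definition MAR (Psi_t : Type) (Psi : set Psi_t) Y
    (g : Psi_t -> k.-tuple bool -> k.-tuple R -> R) :=
  forall psi, Psi psi -> forall r,
    exists h : (count id r).-tuple R -> R,
      (forall u, 0 <= h u <= 1) /\
      {ae lebesgue_tuple R k, forall y, Y y -> g psi r y = h (subvec r y)}.

Definition missing_range Y r (u : (count id r).-tuple R) :
    set ((count id (cpl r)).-tuple R) :=
  [set z | Y (combine u z)].

Definition obs_density Y p r (u : (count id r).-tuple R) : \bar R :=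
  (\int[lebesgue_tuple R _]_(z in missing_range Y u) (p (combine u z))%:E)%E.

Definition cond_density Y p r (z : (count id (cpl r)).-tuple R)
    (u : (count id r).-tuple R) : R :=
  p (combine u z) / fine (obs_density Y p u).

(* The conditional density of the missing subvector given y^(r) = u exists. *)
Definition cond_defined Y p r (u : (count id r).-tuple R) : Prop :=
  (0 < obs_density Y p u < +oo)%E.

Definition LIG_integral Y p (g : k.-tuple bool -> k.-tuple R -> R) r
    (u : (count id r).-tuple R) : \bar R :=
  (\int[lebesgue_tuple R _]_(z in missing_range Y u)
    (cond_density Y p z u * g r (combine u z))%:E)%E.

(* For almost all (y, r) the integral takes the same value at all the theta for
   which the conditional density given y^(r) is defined (outside of them it would
   be a division by 0 or +oo, e.g. when the support of f(.; theta) depends on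
   theta). The exceptional null set may depend on psi but not on theta. *)
Definition LIG (Theta_t Psi_t : Type) (Theta : set Theta_t) (Psi : set Psi_t) Y
    (f : Theta_t -> k.-tuple R -> R)
    (g : Psi_t -> k.-tuple bool -> k.-tuple R -> R) :=
  forall psi, Psi psi -> forall r,
    {ae lebesgue_tuple R k, forall y, Y y ->
      forall th1 th2, Theta th1 -> Theta th2 ->
        cond_defined Y (f th1) (subvec r y) ->
        cond_defined Y (f th2) (subvec r y) ->
        LIG_integral Y (f th1) (g psi) (subvec r y) =
        LIG_integral Y (f th2) (g psi) (subvec r y)}.

End missing_data.

(* Main.v *)
(* Fix psi and a pattern r, write y = (u, z) for the observed and missing parts,
   D(th) for the set of u at which the conditional density of z is defined, and
   I(th, u) for the ignorability integral, so that
     int g(u, z) f(u, z; th) dz = I(th, u) int f(u, z; th) dz on D(th).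
   If g depends on u only, I(th, u) = g for every th. Conversely, if I(th, u)
   does not depend on th, then t = 1_{D(th)}(u) (g(y) - I(th, u)) integrates
   to 0 against every f(.; th'), so by completeness g(y) = I(th, u) a.e. on D(th).
   This cannot be glued over th directly, Theta being uncountable. Instead, for
   rational q compare A = {y | g(y) > q} with the set B of the u whose section
   A_u is not negligible: on D(th), g is a.e. constant along a.e. section, so
   1_A(y) - 1_B(u) integrates to 0 against f(.; th), and completeness applied
   once more gives g(y) > q <-> u \in B for all rational q and almost all y.
   Hence g(y) is a.e. a function of u. *)
Require Import Defs.
From HB Require Import structures.
From mathcomp Require Import all_boot all_order all_algebra.
From mathcomp Require Import all_classical all_reals all_analysis.
From mathcomp Require Import measurable_realfun.

Set Implicit Arguments.
Unset Strict Implicit.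
Unset Printing Implicit Defensive.

Import Order.TTheory GRing.Theory Num.Theory.

Local Open Scope classical_set_scope.
Local Open Scope ring_scope.

(** * Boxes: a generating class for the sigma-algebra on tuples, and its Lebesgue measure *)

Definition box (T : Type) (n : nat) (B : n.-tuple (set T)) : set (n.-tuple T) :=
  [set t | forall i, tnth B i (tnth t i)].

Lemma measurable_box d (T : measurableType d) (n : nat) (B : n.-tuple (set T)) :
  (forall i, measurable (tnth B i)) -> measurable (box B).
Proof.
move=> mB; rewrite (_ : box B =
    \bigcap_(i in [set: 'I_n]) ((@tnth n T ^~ i) @^-1` tnth B i)); last first.
  by apply/seteqP; split => t tB i; [move=> _; exact: tB|exact: (tB i)].
apply: fin_bigcap_measurable; first exact: finite_finset.
by move=> i _; rewrite -[X in measurable X]setTI; exact: measurable_tnth.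
Qed.

Section boxes.
Context d (T : measurableType d) (n : nat).

Definition boxes : set (set (n.-tuple T)) :=
  [set A | exists2 B : n.-tuple (set T),
     (forall i, measurable (tnth B i)) & A = box B].

Lemma boxes_setI : setI_closed boxes.
Proof.
move=> _ _ [B mB ->] [C mC ->].
exists [tuple tnth B i `&` tnth C i | i < n].
  by move=> i; rewrite tnth_mktuple; exact: measurableI.
apply/seteqP; split => t.
  by move=> [tB tC] i; rewrite tnth_mktuple; split; [exact: tB|exact: tC].
by move=> tBC; split => i; have := tBC i; rewrite tnth_mktuple => -[].
Qed.

(** The sigma-algebra on tuples is generated by the preimages of measurable sets under the
    coordinates. Such a preimage is the box with one prescribed side and all other sides [setT]. *)
Lemma measurable_boxes : @measurable _ (n.-tuple T) = <<s boxes >>.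
Proof.
apply/seteqP; split; last first.
  by apply: smallest_sub; [exact: sigma_algebra_measurable|
    move=> _ [B mB ->]; exact: measurable_box].
apply: smallest_sub; first exact: smallest_sigma_algebra.
rewrite -bigcup_seq => A [i /= _ [B mB <-]]; apply: sub_gen_smallest.
exists [tuple if j == i then B else setT | j < n].
  by move=> j; rewrite tnth_mktuple; case: ifP.
apply/seteqP; split => t.
  by move=> [_ tB] j; rewrite tnth_mktuple; case: eqVneq => [->|].
by move=> /(_ i); rewrite tnth_mktuple eqxx.
Qed.

End boxes.

Lemma lebesgue_tuple_boxE (R : realType) (n : nat) (B : n.-tuple (set R)) :
  (forall i, measurable (tnth B i)) ->
  lebesgue_tuple R n (box B) = (\prod_(A <- B) lebesgue_measure A)%E.
Proof.
move=> mB; rewrite [LHS](lebesgue_tuple_box mB) [in RHS](tuple_map_ord B).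
by rewrite big_map big_enum.
Qed.

(** Serves to split the volume of a box into the volumes of its observed and missing faces. *)
Lemma big_mask_negb (T : Type) (M : Type) (idx : M) (op : Monoid.com_law idx)
    (m : bitseq) (s : seq T) (F : T -> M) : size m = size s ->
  op (\big[op/idx]_(x <- mask m s) F x)
     (\big[op/idx]_(x <- mask (map negb m) s) F x) = \big[op/idx]_(x <- s) F x.
Proof.
elim: m s => [|b m IHm] [|x s]//=; first by rewrite !big_nil Monoid.mulm1.
move=> [/IHm E]; case: b => /=; rewrite !big_cons -E.
  by rewrite Monoid.mulmA.
by rewrite Monoid.mulmCA.
Qed.

(** * Coordinates of the observed and missing subvectors *)

Section subvector.
Context {k : nat}.
Implicit Type r : k.-tuple bool.

(** The index [i] is chosen before [T] and [y], so that the same index serves for a vector of reals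
    and for the vector of sides of a box. *)
Lemma tnth_subvec r (j : 'I_(count id r)) :
  exists2 i : 'I_k, tnth r i &
    forall (T : Type) (y : k.-tuple T), tnth (subvec r y) j = tnth y i.
Proof.
have [i [ir ri ji]] := count_take_surj (ltn_ord j).
have ik : (i < k)%N by rewrite -(size_tuple r).
exists (Ordinal ik); first by rewrite (tnth_nth false).
move=> T y; pose x0 := tnth y (Ordinal ik).
by rewrite (tnth_nth x0) [RHS](tnth_nth x0) /= -ji nth_mask_count.
Qed.

Lemma tnth_subvecV r (i : 'I_k) : tnth r i ->
  exists j : 'I_(count id r),
    forall (T : Type) (y : k.-tuple T), tnth (subvec r y) j = tnth y i.
Proof.
move=> ri; have ir : (i < size r)%N by rewrite size_tuple.
have rI : nth false r i by rewrite -tnth_nth.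
(* The place of [i] in the subvector is the number of selected indices before it. The bound is
   strict because [i] itself is selected and is not among them. *)
have jr : (count id (take i r) < count id r)%N.
  rewrite -[in X in (_ < X)%N](cat_take_drop i r) count_cat.
  by rewrite -[X in (X < _)%N]addn0 ltn_add2l (drop_nth false)//= rI.
exists (Ordinal jr) => T y; pose x0 := tnth y i.
by rewrite (tnth_nth x0) [RHS](tnth_nth x0) /= nth_mask_count.
Qed.

Lemma tnth_cpl r (i : 'I_k) : tnth (cpl r) i = ~~ tnth r i.
Proof. by rewrite tnth_map. Qed.

Lemma box_subvec (T : Type) r (B : k.-tuple (set T)) (y : k.-tuple T) :
  box B y <-> box (subvec r B) (subvec r y) /\
              box (subvec (cpl r) B) (subvec (cpl r) y).
Proof.
split=> [By|[Br Bcr] i].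
  by split=> j; have [i _ E] := tnth_subvec j; rewrite !E; exact: By.
have [ri|ri] := boolP (tnth r i).
  by have [j E] := tnth_subvecV ri; have := Br j; rewrite !E.
rewrite -tnth_cpl in ri.
by have [j E] := tnth_subvecV ri; have := Bcr j; rewrite !E.
Qed.

Context {R : realType}.

Lemma measurable_subvec r : measurable_fun setT (@subvec k R r).
Proof.
apply/measurable_fun_tnthP => j; have [i _ E] := tnth_subvec j.
rewrite (_ : _ \o _ = @tnth k R ^~ i); first exact: measurable_tnth.
by apply/funext => y /=; exact: E.
Qed.

(** Uncurried, so that the product measure can be pushed forward along it. *)
Definition ucombine r
    (p : (count id r).-tuple R * (count id (cpl r)).-tuple R) : k.-tuple R :=
  combine p.1 p.2.

Lemma measurable_ucombine r : measurable_fun setT (@ucombine r).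
Proof.
apply/measurable_fun_tnthP => i.
have [ri|ri] := boolP (tnth r i).
  have [j E] := tnth_subvecV ri.
  rewrite (_ : _ \o _ = @tnth _ R ^~ j \o fst).
    exact: measurableT_comp (@measurable_tnth _ _ _ _) measurable_fst.
  by apply/funext => -[u z] /=; rewrite -E combineKl.
rewrite -tnth_cpl in ri.
have [j E] := tnth_subvecV ri.
rewrite (_ : _ \o _ = @tnth _ R ^~ j \o snd).
  exact: measurableT_comp (@measurable_tnth _ _ _ _) measurable_snd.
by apply/funext => -[u z] /=; rewrite -E combineKr.
Qed.

HB.instance Definition _ r :=
  isMeasurableFun.Build _ _ _ _ (@ucombine r) (@measurable_ucombine r).

Local Notation lam := (lebesgue_tuple R).

(* Both measures agree on boxes, which generate the sigma-algebra. *)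
Lemma lebesgue_ucombine r (A : set (k.-tuple R)) : measurable A ->
  lam k A = pushforward (lam _ \x lam _)%E (@ucombine r) A.
Proof.
move=> mA; pose T : measurableType _ := k.-tuple R.
apply: (@measure_unique _ R T (@boxes _ _ k)
    (fun n => box [tuple [set` `[- n%:R, n%:R : R]] | _ < k]) _ _ _ _ (lam k)
    (pushforward (lam _ \x lam _)%E (@ucombine r))) => //.
- exact: measurable_boxes.
- exact: boxes_setI.
- by move=> n; exists [tuple [set` `[- n%:R, n%:R : R]] | _ < k] => // i;
    rewrite tnth_mktuple.
- rewrite -subTset => t _.
  (* Every coordinate is bounded by the sum of all absolute values, so a cube of this size contains
     [t]. *)
  exists (Num.truncn (\sum_i `|tnth t i|)).+1 => // i.
  rewrite tnth_mktuple /= in_itv/= -ler_norml.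
  rewrite (le_trans _ (ltW (truncnS_gt _)))//.
  by rewrite (bigD1 i)//= lerDl sumr_ge0.
- move=> _ [B mB ->]; rewrite -[LHS]/(lam k (box B)) lebesgue_tuple_boxE//.
  rewrite -[RHS]/((lam _ \x lam _)%E (@ucombine r @^-1` box B)).
  have mBr s i : measurable (tnth (subvec s B) i).
    by have [j _ ->] := tnth_subvec i.
  rewrite (_ : _ @^-1` _ = box (subvec r B) `*` box (subvec (cpl r) B)).
    rewrite product_measure1E; [|exact: measurable_box..].
    rewrite -[X in (X * _)%E]/(lam _ (box (subvec r B))) !lebesgue_tuple_boxE//.
    by rewrite -(@big_mask_negb _ _ _ _ r)// !size_tuple.
  apply/seteqP; split => -[u z]; rewrite /= /ucombine.
    by move/(box_subvec r); rewrite combineKl combineKr.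
  by move=> buz; apply/(box_subvec r); rewrite combineKl combineKr.
- move=> n; rewrite -[X in (X < _)%E]/(lam k _) lebesgue_tuple_boxE; last first.
    by move=> i; rewrite tnth_mktuple.
  rewrite big_map ltey_eq prode_fin_num// => i _.
  by rewrite lebesgue_measure_itv/=; case: ifP.
Qed.

End subvector.

(** * Integrals and null sets along the sections with fixed observed part *)

Section sections.
Context {R : realType} {k : nat} (r : k.-tuple bool).
Implicit Types (Y : set (k.-tuple R)) (F : k.-tuple R -> \bar R).

Local Notation lam := (lebesgue_tuple R).

Lemma measurable_preimage_ucombine Y :
  measurable Y -> measurable (@ucombine _ _ r @^-1` Y).
Proof.
by move=> mY; rewrite -[X in measurable X]setTI; exact: measurable_ucombine.
Qed.

Lemma missing_rangeE Y (u : (count id r).-tuple R) :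
  missing_range Y u = xsection (@ucombine _ _ r @^-1` Y) u.
Proof. by apply/seteqP; split => z; rewrite /xsection /= inE. Qed.

Lemma measurable_missing_range Y (u : (count id r).-tuple R) :
  measurable Y -> measurable (missing_range Y u).
Proof.
move=> mY; rewrite missing_rangeE; apply: measurable_xsection.
exact: measurable_preimage_ucombine.
Qed.

Lemma measurable_combine (u : (count id r).-tuple R) :
  measurable_fun setT (combine u).
Proof.
rewrite (_ : combine u = @ucombine _ _ r \o pair u)//.
apply: measurableT_comp; first exact: measurable_ucombine.
exact: pair1_measurable.
Qed.

Lemma measurable_fun_missing Y F (u : (count id r).-tuple R) :
  measurable Y -> measurable_fun Y F ->
  measurable_fun (missing_range Y u) (fun z => F (combine u z)).
Proof.
move=> mY mF; apply: (measurable_comp mY _ mF); first by move=> _ [z Yz <-].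
by apply: measurable_funTS; exact: measurable_combine.
Qed.

Let restrict_ge0 Y F : (forall y, Y y -> 0 <= F y)%E ->
  forall y, (0 <= (F \_ Y) y)%E.
Proof. by move=> F0 y; rewrite patchE; case: ifPn => // /[!inE]; exact: F0. Qed.

Let section_restrict Y F u :
  (\int[lam _]_(z in missing_range Y u) F (combine u z) =
   \int[lam _]_z ((F \_ Y) \o @ucombine _ _ r) (u, z))%E.
Proof.
rewrite integral_mkcond; apply: eq_integral => z _.
rewrite !patchE /= patchE (_ : (z \in _) = (ucombine (u, z) \in Y))//.
Qed.

(** Tonelli on observed times missing coordinates, transported by [ucombine]. Extending [F] by 0
    outside [Y] turns the section domains into the whole space. *)
Lemma integral_missing Y F : measurable Y -> measurable_fun Y F ->
  (forall y, Y y -> 0 <= F y)%E ->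
  (\int[lam k]_(y in Y) F y = \int[lam (count id r)]_u
     \int[lam _]_(z in missing_range Y u) F (combine u z))%E.
Proof.
move=> mY /(measurable_restrictT _ mY) mF F0.
rewrite integral_mkcond (eq_measure_integral
  (pushforward (lam _ \x lam _)%E (@ucombine _ _ r))); last first.
  by move=> A mA _; exact: lebesgue_ucombine.
rewrite (ge0_integral_pushforward (@measurable_ucombine _ _ r)
  (lam _ \x lam _)%E measurableT mF); last by move=> y _; exact: restrict_ge0.
rewrite preimage_setT fubini_tonelli1.
- by apply: eq_integral => u _; rewrite section_restrict.
- by apply: measurableT_comp => //; exact: measurable_ucombine.
- by move=> p; exact: restrict_ge0.
Qed.

Lemma measurable_missing_integral Y F : measurable Y -> measurable_fun Y F ->
  (forall y, Y y -> 0 <= F y)%E ->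
  measurable_fun setT (fun u : (count id r).-tuple R =>
    \int[lam _]_(z in missing_range Y u) F (combine u z))%E.
Proof.
move=> mY /(measurable_restrictT _ mY) mF F0.
rewrite (funext (section_restrict Y F)).
apply: (@measurable_fun_fubini_tonelli_F _ _ _ _ _ _
  ((F \_ Y) \o @ucombine _ _ r)).
  by apply: measurableT_comp => //; exact: measurable_ucombine.
by move=> p; exact: restrict_ge0.
Qed.

(** The measure of a null set is the integral of the measures of its sections, so almost every
    section is null. *)
Lemma ae_combine (Q : k.-tuple R -> Prop) : {ae lam k, forall y, Q y} ->
  {ae lam (count id r), forall u, {ae lam _, forall z, Q (combine u z)}}.
Proof.
move=> [N [mN]]; rewrite (lebesgue_ucombine r)// => N0 QN.
have mN' := measurable_preimage_ucombine mN.
pose xs := lam (count id (cpl r)) \o xsection (@ucombine _ _ r @^-1` N).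
have mxs : measurable_fun setT xs by exact: measurable_fun_xsection.
have : ae_eq (lam (count id r)) setT xs (cst 0%E).
  apply/(ae_eq_integral_abs _ measurableT mxs); rewrite -N0.
  by apply: eq_integral => u _; rewrite gee0_abs.
apply: filterS => u u0; exists (missing_range N u); split.
- exact: measurable_missing_range.
- by rewrite missing_rangeE; exact: u0.
- by move=> z nQ; apply: QN.
Qed.

(** The preimage of a null set [N] is the cylinder over [N], of measure 0 even though its other
    factor may have infinite measure. *)
Lemma ae_subvec (Q : (count id r).-tuple R -> Prop) :
  {ae lam _, forall u, Q u} -> {ae lam k, forall y, Q (subvec r y)}.
Proof.
move=> [N [mN N0 QN]].
have mN' : measurable (@subvec k R r @^-1` N).
  by rewrite -[X in measurable X]setTI; exact: measurable_subvec.
exists (@subvec k R r @^-1` N); split => //; last by move=> y nQ; exact: QN.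
rewrite (lebesgue_ucombine r)// /pushforward.
rewrite (_ : _ @^-1` _ = N `*` setT).
  by rewrite product_measure1E// [X in (X * _)%E]N0 mul0e.
by apply/seteqP; split => -[u z]; rewrite /= /ucombine/= combineKl// => -[].
Qed.

End sections.

(** * The observed density, and integrals against a single density *)

Section conditional.
Context {R : realType} {k : nat} (r : k.-tuple bool).
Variables (Y : set (k.-tuple R)) (p : k.-tuple R -> R).
Hypotheses (mY : measurable Y) (dp : is_density Y p).
Implicit Types (u : (count id r).-tuple R) (G : k.-tuple R -> R).

Local Notation lam := (lebesgue_tuple R).

Let mp : measurable_fun Y p. Proof. by case: dp. Qed.
Let p0 y : Y y -> 0 <= p y. Proof. by case: dp => _ + _; exact. Qed.
Let mEp : measurable_fun Y (EFin \o p). Proof. exact/measurable_EFinP. Qed.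

Lemma obs_density_ge0 u : (0 <= obs_density Y p u)%E.
Proof. by apply: integral_ge0 => z Yz; rewrite lee_fin; exact: p0. Qed.

Lemma measurable_obs_density : measurable_fun setT (@obs_density _ _ Y p r).
Proof.
apply: (measurable_missing_integral mY mEp) => y Yy.
by rewrite lee_fin; exact: p0.
Qed.

Lemma integral_obs_density : (\int[lam _]_u (@obs_density _ _ Y p r) u = 1)%E.
Proof.
by case: dp => _ _ <-; rewrite (integral_missing r mY mEp).
Qed.

Lemma ae_obs_density_fin :
  {ae lam _, forall u, obs_density Y p u \is a fin_num}.
Proof.
have : (lam (count id r)).-integrable setT (@obs_density _ _ Y p r).
  apply/integrableP; split; first exact: measurable_obs_density.
  under eq_integral do rewrite gee0_abs ?obs_density_ge0//.
  by rewrite integral_obs_density ltry.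
move/(integrable_ae measurableT); apply: filterS => u; exact.
Qed.

Lemma measurable_cond_defined : measurable (@cond_defined _ _ Y p r).
Proof.
have -> : @cond_defined _ _ Y p r =
    setT `&` @obs_density _ _ Y p r @^-1` [set` `]0%E, +oo%E[].
  by rewrite setTI; apply/seteqP; split => u; rewrite /= in_itv.
by apply: measurable_obs_density => //; exact: emeasurable_itv.
Qed.

(** A section of positive observed density is not negligible, so a statement free of z that holds
    for almost all z in it is true. If [Q] failed, almost no z would lie in the section and the
    observed density would vanish. *)
Lemma cond_defined_ae u (Q : Prop) : cond_defined Y p u ->
  {ae lam _, forall z, missing_range Y u z -> Q} -> Q.
Proof.
move=> /andP[+ _] QY; apply: contraPP => nQ; apply/negP; rewrite -leNgt.
have -> : obs_density Y p u = (\int[lam _]_(z in missing_range Y u) 0)%E.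
  apply: ae_eq_integral => //; first exact: measurable_missing_range.
    exact: (measurable_fun_missing mY mEp).
  by apply: filterS QY => z QYz /QYz.
by rewrite integral0.
Qed.

Let mpG G : measurable_fun Y G ->
  measurable_fun Y (fun y => (G y * p y)%:E).
Proof. by move=> mG; apply/measurable_EFinP; exact: measurable_funM. Qed.

Lemma integral_missing_le_obs_density G u : measurable_fun Y G ->
  (forall y, Y y -> 0 <= G y <= 1) ->
  (0 <= \int[lam _]_(z in missing_range Y u)
     (G (combine u z) * p (combine u z))%:E <= obs_density Y p u)%E.
Proof.
move=> mG G01; apply/andP; split.
  apply: integral_ge0 => z Yz; rewrite lee_fin mulr_ge0 ?p0//.
  by case/andP: (G01 _ Yz).
apply: ge0_le_integral.
- exact: measurable_missing_range.
- by move=> z Yz; rewrite lee_fin mulr_ge0 ?p0//; case/andP: (G01 _ Yz).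
- exact: (measurable_fun_missing mY (mpG mG)).
- exact: (measurable_fun_missing mY mEp).
- by move=> z Yz; rewrite lee_fin ler_piMl ?p0//; case/andP: (G01 _ Yz).
Qed.

Lemma integral_missing_const G u (c : R) : measurable_fun Y G ->
  {ae lam _, forall z, missing_range Y u z -> G (combine u z) = c} -> 0 <= c ->
  (\int[lam _]_(z in missing_range Y u) (G (combine u z) * p (combine u z))%:E =
   c%:E * obs_density Y p u)%E.
Proof.
move=> mG Gc c0.
have mr := measurable_missing_range u mY.
rewrite -ge0_integralZl_EFin//; last 2 first.
- by move=> z Yz; rewrite lee_fin p0.
- exact: (measurable_fun_missing mY mEp).
apply: ae_eq_integral => //.
- exact: (measurable_fun_missing mY (mpG mG)).
- by apply: measurable_funeM; exact: (measurable_fun_missing mY mEp).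
- by apply: filterS Gc => z Gz /Gz /= ->; rewrite EFinM.
Qed.

(** Prepares both uses of completeness: if [H] is the conditional mean of [G] given the observed
    part, then [G - H] is integrable against [p] with integral 0. The bounds by 1 make both terms
    integrable, and Tonelli compares them section by section. *)
Lemma integral_subr_subvec G (H : (count id r).-tuple R -> R) :
  measurable_fun Y G -> (forall y, Y y -> 0 <= G y <= 1) ->
  measurable_fun setT H -> (forall u, 0 <= H u <= 1) ->
  {ae lam _, forall u, cond_defined Y p u ->
    (\int[lam _]_(z in missing_range Y u)
       (G (combine u z) * p (combine u z))%:E =
     (H u)%:E * obs_density Y p u)%E} ->
  (lam k).-integrable Y (fun y => ((G y - H (subvec r y)) * p y)%:E) /\
  (\int[lam k]_(y in Y) ((G y - H (subvec r y)) * p y)%:E = 0)%E.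
Proof.
move=> mG G01 mH H01 GH.
have ip : (lam k).-integrable Y (EFin \o p).
  apply/integrableP; split => //; case: dp => _ _.
  rewrite (_ : (\int[_]_(x in Y) (p x)%:E)%E =
    (\int[lam k]_(x in Y) `|(EFin \o p) x|)%E).
    by move=> ->; rewrite ltry.
  by apply: eq_integral => y /[!inE] Yy; rewrite gee0_abs// lee_fin p0.
have integrable01 (F : k.-tuple R -> R) : measurable_fun Y F ->
    (forall y, Y y -> 0 <= F y <= 1) ->
    (lam k).-integrable Y (fun y => (F y * p y)%:E).
  move=> mF F01; apply: le_integrable ip => //; first exact: mpG.
  move=> y Yy; have /andP[F0 F1] := F01 _ Yy.
  by rewrite /= lee_fin normrM ger0_norm// ler_piMl.
have mHs : measurable_fun Y (H \o subvec r).
  apply: measurable_funTS; apply: measurableT_comp => //.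
  exact: measurable_subvec.
have iG := integrable01 _ mG G01.
have iH := integrable01 _ mHs (fun y _ => H01 (subvec r y)).
have E : (fun y => ((G y - H (subvec r y)) * p y)%:E) =
    (fun y => (G y * p y)%:E - ((H \o subvec r) y * p y)%:E)%E.
  by apply/funext => y; rewrite mulrBl EFinB.
rewrite E; split; first exact: integrableB.
rewrite integralB_EFin//.
suff -> : (\int[lam k]_(y in Y) (G y * p y)%:E =
    \int[lam k]_(y in Y) ((H \o subvec r) y * p y)%:E)%E.
  by rewrite subee// integrable_fin_num.
have ge0 (F : k.-tuple R -> R) : (forall y, Y y -> 0 <= F y <= 1) ->
    forall y, Y y -> (0 <= (F y * p y)%:E)%E.
  by move=> F01 y Yy; rewrite lee_fin mulr_ge0 ?p0//; case/andP: (F01 _ Yy).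
have gG := ge0 _ G01; have gH := ge0 _ (fun y _ => H01 (subvec r y)).
rewrite !(integral_missing r mY)//; [|exact: mpG..].
apply: ae_eq_integral => //; [exact: measurable_missing_integral (mpG mG) gG|
  exact: measurable_missing_integral (mpG mHs) gH|].
apply: filterS2 GH ae_obs_density_fin => u GHu fu _.
rewrite (@integral_missing_const (H \o subvec r) u (H u))//; last 2 first.
- by apply: aeW => z _ /=; rewrite combineKl.
- by case/andP: (H01 u).
(* Where the observed density is 0 both sides vanish, and it is infinite only on a null set. What is
   left is [cond_defined]. *)
have [u0|u0] := eqVneq (obs_density Y p u) 0%E.
  have := integral_missing_le_obs_density u mG G01.
  by rewrite u0 mule0 => /le_anti.
apply: GHu; rewrite /cond_defined lt_neqAle eq_sym u0 obs_density_ge0 /=.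
by rewrite ltey_eq fu.
Qed.

(** * The ignorability integral as a function of the observed part *)

Section mechanism.
Variable g : k.-tuple bool -> k.-tuple R -> R.
Hypothesis mg : is_mechanism Y g.

Lemma mechanism01 y : Y y -> 0 <= g r y <= 1.
Proof.
case: mg => _ g0 g1 Yy; rewrite g0//= -(g1 y Yy) (bigD1 r)//= lerDl.
by apply: sumr_ge0 => s _; exact: g0.
Qed.

Let mgr : measurable_fun Y (g r). Proof. by case: mg. Qed.

Lemma LIG_integralE u : cond_defined Y p u ->
  LIG_integral Y p g u = ((fine (obs_density Y p u))^-1%:E *
   \int[lam _]_(z in missing_range Y u)
     (g r (combine u z) * p (combine u z))%:E)%E.
Proof.
move=> /andP[u0 uoo]; rewrite -ge0_integralZl_EFin.
- by apply: eq_integral => z _; rewrite -EFinM /cond_density mulrC mulrA mulrC.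
- exact: measurable_missing_range.
- move=> z Yz; rewrite lee_fin mulr_ge0 ?p0//.
  by case/andP: (mechanism01 Yz).
- exact: (measurable_fun_missing mY (mpG mgr)).
- by rewrite invr_ge0 fine_ge0// ltW.
Qed.

Lemma LIG_integralM u : cond_defined Y p u ->
  (\int[lam _]_(z in missing_range Y u)
     (g r (combine u z) * p (combine u z))%:E =
   LIG_integral Y p g u * obs_density Y p u)%E.
Proof.
move=> du; rewrite LIG_integralE// muleAC; case/andP: du => u0 uoo.
have ufin : obs_density Y p u \is a fin_num by rewrite ge0_fin_numE// ltW.
have v0 : fine (obs_density Y p u) != 0 by rewrite gt_eqF// fine_gt0// u0.
by rewrite -[X in (_ * X * _)%E](fineK ufin) -EFinM mulVf// mul1e.
Qed.

Lemma LIG_integral01 u : cond_defined Y p u ->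
  (0 <= LIG_integral Y p g u <= 1)%E.
Proof.
move=> du; rewrite LIG_integralE//; case/andP: du => u0 uoo.
have ufin : obs_density Y p u \is a fin_num by rewrite ge0_fin_numE// ltW.
have v0 : 0 < fine (obs_density Y p u) by rewrite fine_gt0// u0.
have /andP[J0 J1] := integral_missing_le_obs_density u mgr mechanism01.
rewrite mule_ge0 ?lee_fin ?invr_ge0 ?(ltW v0)//=.
apply: (le_trans (lee_wpmul2l _ J1)); first by rewrite lee_fin invr_ge0 ltW.
by rewrite -[X in (_ * X)%E](fineK ufin) -EFinM mulVf// gt_eqF.
Qed.

Lemma measurable_LIG_integral :
  measurable_fun setT (@LIG_integral _ _ Y p g r).
Proof.
(* The integrand is written as a function of the whole vector, so that measurability of section
   integrals applies. *)
pose F y := (cond_density Y p (subvec (cpl r) y) (subvec r y) * g r y)%:E.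
have FE u z : F (combine u z) = (cond_density Y p z u * g r (combine u z))%:E.
  by rewrite /F combineKl combineKr.
have -> : @LIG_integral _ _ Y p g r = fun u =>
    (\int[lam _]_(z in missing_range Y u) F (combine u z))%E.
  by apply/funext => u; apply: eq_integral => z _; rewrite FE.
apply: measurable_missing_integral => //.
- apply/measurable_EFinP; apply: measurable_funM => //.
  (* The inverse becomes the measurable power -1. They agree for nonnegative arguments, also at 0,
     where both are 0. *)
  rewrite (_ : (fun _ => _) =
      fun y => p y * fine (obs_density Y p (subvec r y)) `^ (-1)); last first.
    apply/funext => y; rewrite /cond_density subvecK powR_inv1//.
    by rewrite fine_ge0// obs_density_ge0.
  apply: measurable_funM => //; apply: measurable_funTS.
  apply: (measurableT_comp (@measurable_powR _ (-1))).
  apply: (measurableT_comp (@fine_measurable _ _ measurableT)).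
  by apply: (measurableT_comp measurable_obs_density); exact: measurable_subvec.
- move=> y Yy; rewrite lee_fin mulr_ge0//; last by case/andP: (mechanism01 Yy).
  by rewrite /cond_density subvecK divr_ge0 ?p0// fine_ge0// obs_density_ge0.
Qed.

End mechanism.
End conditional.

(** * Equivalence of likelihood ignorability and missingness at random *)

Section ignorability.
Context {R : realType} {k : nat} (Theta_t Psi_t : Type).
Variables (Theta : set Theta_t) (Psi : set Psi_t) (Y : set (k.-tuple R)).
Variables (f : Theta_t -> k.-tuple R -> R).
Variables (g : Psi_t -> k.-tuple bool -> k.-tuple R -> R).
Hypothesis mY : measurable Y.
Hypothesis df : forall th, Theta th -> is_density Y (f th).
Hypothesis mg : forall psi, Psi psi -> is_mechanism Y (g psi).

Local Notation lam := (lebesgue_tuple R).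

Lemma MAR_LIG : MAR Psi Y g -> LIG Theta Psi Y f g.
Proof.
move=> mar psi Ppsi r; have [h [h01 gh]] := mar _ Ppsi r.
have mgr : measurable_fun Y (g psi r) by case: (mg Ppsi).
(* Here [th] is quantified inside the almost everywhere: the null set comes from MAR, which does not
   involve [th]. *)
suff : {ae lam _, forall u : (count id r).-tuple R, forall th, Theta th ->
    cond_defined Y (f th) u -> LIG_integral Y (f th) (g psi) u = (h u)%:E}.
  move=> /ae_subvec; apply: filterS => y E _ th1 th2 T1 T2 d1 d2.
  by rewrite !E.
apply: filterS (ae_combine r gh) => u ghu th Tth du.
rewrite (LIG_integralE mY (df Tth) (mg Ppsi))//.
rewrite (integral_missing_const mY (df Tth) (c := h u))//; last 2 first.
- by apply: filterS ghu => z E Yz; rewrite E// combineKl.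
- by case/andP: (h01 u).
case/andP: du => u0 uoo.
have ufin : obs_density Y (f th) u \is a fin_num by rewrite ge0_fin_numE// ltW.
rewrite -[X in (_ * (_ * X))%E](fineK ufin) -!EFinM mulrCA mulVf ?mulr1//.
by rewrite gt_eqF// fine_gt0// u0.
Qed.

Hypothesis completef : complete_family Theta Y f.

(** First use of completeness, with [th] fixed; the exceptional null set may depend on [th]. *)
Lemma LIG_ae_eq psi r th : Psi psi -> Theta th -> LIG Theta Psi Y f g ->
  {ae lam k, forall y, Y y -> cond_defined Y (f th) (subvec r y) ->
    g psi r y = fine (LIG_integral Y (f th) (g psi) (subvec r y))}.
Proof.
move=> Ppsi Tth lig.
have mgr : measurable_fun Y (g psi r) by case: (mg Ppsi).
have fin_LIG t u : Theta t -> @cond_defined _ _ Y (f t) r u ->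
    LIG_integral Y (f t) (g psi) u \is a fin_num.
  move=> Tt /(LIG_integral01 mY (df Tt) (mg Ppsi))/andP[I0 I1].
  by rewrite ge0_fin_numE// (le_lt_trans I1)// ltry.
pose D : set ((count id r).-tuple R) := @cond_defined _ _ Y (f th) r.
have mD : measurable D by exact: (measurable_cond_defined mY (df Tth)).
pose I (u : (count id r).-tuple R) := LIG_integral Y (f th) (g psi) u.
(* The indicator of [D] keeps [H] in [0,1] and makes both functions vanish where the conditional
   density at [th] is undefined. *)
pose H u := \1_D u * fine (I u).
pose G y := \1_D (subvec r y) * g psi r y.
have m1D : measurable_fun setT (\1_D : _ -> R) by exact: measurable_indic.
have mG : measurable_fun Y G.
  apply: measurable_funM => //; apply: measurable_funTS.
  by apply: (measurableT_comp m1D); exact: measurable_subvec.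
have mH : measurable_fun setT H.
  apply: measurable_funM => //.
  apply: (measurableT_comp (@fine_measurable _ _ measurableT)).
  exact: (measurable_LIG_integral mY (df Tth) (mg Ppsi)).
have G01 y : Y y -> 0 <= G y <= 1.
  move=> Yy; rewrite /G indicE; case: (_ \in _); rewrite ?mul0r ?ler01 ?lexx//.
  by rewrite mul1r (mechanism01 r (mg Ppsi) Yy).
have H01 u : 0 <= H u <= 1.
  rewrite /H indicE; have [|_] := boolP (u \in D); last first.
    by rewrite mul0r lexx ler01.
  rewrite inE mul1r -!lee_fin => Du; rewrite fineK; last exact: fin_LIG.
  exact: (LIG_integral01 mY (df Tth) (mg Ppsi) Du).
suff : {ae lam k, forall y, Y y -> G y - H (subvec r y) = 0}.
  apply: filterS => y E Yy Dy; move/eqP: (E Yy).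
  by rewrite /G /H indicE mem_set// !mul1r subr_eq0 => /eqP.
apply: completef.
  apply: measurable_funB => //; apply: measurable_funTS.
  by apply: (measurableT_comp mH); exact: measurable_subvec.
move=> th' Tth'; apply: (integral_subr_subvec mY (df Tth')) => //.
apply: filterS (ae_combine r (lig _ Ppsi r)) => u ligu du'.
rewrite /H /G.
under eq_integral do rewrite combineKl.
have [Du|nDu] := pselect (D u); last first.
  by rewrite indicE memNset// mul0r mul0e integral0_eq// => z _; rewrite !mul0r.
rewrite indicE mem_set// mul1r.
under eq_integral do rewrite mul1r.
rewrite (LIG_integralM mY (df Tth') (mg Ppsi))//; congr (_ * _)%E.
rewrite fineK; last exact: fin_LIG.
apply: (cond_defined_ae mY (df Tth') du').
apply: filterS ligu => z E Yz; have := E Yz th' th Tth' Tth.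
by rewrite combineKl; exact.
Qed.

Lemma LIG_MAR : LIG Theta Psi Y f g -> MAR Psi Y g.
Proof.
move=> lig psi Ppsi r.
have mgr : measurable_fun Y (g psi r) by case: (mg Ppsi).
pose A (q : R) := Y `&` [set y | q < g psi r y].
(* Defined by the Lebesgue measure of sections, without reference to a parameter, so that one [B q]
   serves for all [th]. *)
pose B (q : R) : set ((count id r).-tuple R) :=
  [set u | 0 < lam _ (missing_range (A q) u)]%E.
have mA q : measurable (A q).
  rewrite (_ : A q = Y `&` g psi r @^-1` [set` `]q, +oo[]); first exact: mgr.
  by congr setI; apply/seteqP; split => y; rewrite /= in_itv/= andbT.
have mB q : measurable (B q).
  rewrite (_ : B q = setT `&`
      (lam _ \o xsection (@ucombine _ _ r @^-1` A q)) @^-1`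
      [set` `]0%E, +oo[]); last first.
    by rewrite setTI; apply/seteqP; split => u;
      rewrite /B /= in_itv/= andbT missing_rangeE.
  apply: measurable_fun_xsection => //; last exact: emeasurable_itv.
  exact: measurable_preimage_ucombine.
have AB q : {ae lam k, forall y, Y y ->
    \1_(A q) y - \1_(B q) (subvec r y) = 0 :> R}.
  have ind01 T (S : set T) x : 0 <= (\1_S x : R) <= 1.
    by rewrite indicE; case: (_ \in _); rewrite ?ler01 ?lexx.
  have m1A : measurable_fun Y (\1_(A q) : _ -> R) by exact: measurable_indic.
  have m1B : measurable_fun setT (\1_(B q) : _ -> R) by exact: measurable_indic.
  apply: completef.
    apply: measurable_funB => //; apply: measurable_funTS.
    by apply: (measurableT_comp m1B); exact: measurable_subvec.
  move=> th Tth; apply: (integral_subr_subvec mY (df Tth)) => //.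
  apply: filterS (ae_combine r (LIG_ae_eq r Ppsi Tth lig)) => u gu du.
  apply: (integral_missing_const mY (df Tth)) => //.
  pose c := fine (LIG_integral Y (f th) (g psi) u).
  have {}gu : {ae lam _, forall z, missing_range Y u z ->
      g psi r (combine u z) = c}.
    by apply: filterS gu => z E Yz; rewrite E ?combineKl.
  (* Since [g] is almost everywhere [c] on the section, the part in [A q] is null when [c <= q] and
     almost the whole section when [q < c]. *)
  suff Bc : B q u <-> q < c.
    apply: filterS gu => z E Yz; rewrite !indicE; congr ((_ : bool)%:R).
    apply/idP/idP; rewrite !inE.
      by move=> [_ /=]; rewrite E// => /Bc.
    by move=> /Bc qc; split => //=; rewrite E.
  have mAu := measurable_missing_range u (mA q).
  split => [|qc].
    rewrite /B /= ltNge; apply: contraNT; rewrite -leNgt => cq.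
    rewrite le_eqVlt; apply/orP; left; apply/eqP/(negligibleP _ mAu).
    apply: (negligibleS _ gu) => z /= [Yz qg] /(_ Yz) gz.
    by move: qg; rewrite /= gz ltNge cq.
  rewrite /B /= lt_neqAle measure_ge0 andbT; apply/negP => /eqP/esym.
  (* Were that part null, the whole section would be null; [cond_defined_ae] with the proposition
     [False] excludes this. *)
  move=> /(negligibleP _ mAu) A0; apply: (cond_defined_ae mY (df Tth) du).
  have : {ae lam _, forall z, ~ missing_range (A q) u z}.
    by apply: (negligibleS _ A0) => z /= /contrapT.
  apply: filterS2 gu => z E nA Yz; apply: nA; split => //=.
  by rewrite E.
(* An enumeration of the rationals, for a countable union of null sets; numbers that code no
   rational give 0, a harmless repetition. *)
pose Q n : rat := odflt 0 (unpickle n).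
pose good y := Y y /\
  forall n, (ratr (Q n) < g psi r y) = (subvec r y \in B (ratr (Q n))).
have good_ae : {ae lam k, forall y, Y y -> good y}.
  apply: filterS (ae_foralln (fun n => AB (ratr (Q n)))) => y E Yy.
  split => // n.
  rewrite (_ : (_ < _) = (y \in A (ratr (Q n)))); last first.
    by apply/idP/idP; rewrite inE => //= -[].
  have /eqP := E n Yy; rewrite subr_eq0 !indicE eqr_nat.
  by case: (_ \in _); case: (_ \in _).
(* Good points with the same observed part lie above the same rationals, so no rational separates
   their values of [g]. The other inequality follows by symmetry. *)
have good_inj y1 y2 : good y1 -> good y2 -> subvec r y1 = subvec r y2 ->
    g psi r y1 <= g psi r y2.
  move=> [_ g1] [_ g2] e; rewrite leNgt; apply/negP => /rat_in_itvoo[q].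
  rewrite in_itv/= => /andP[q2 q1].
  have Qq : Q (pickle q) = q by rewrite /Q pickleK.
  move: (g1 (pickle q)) (g2 (pickle q)); rewrite Qq q1 e => <-.
  by rewrite ltNge (ltW q2).
pose P u y := good y /\ subvec r y = u.
(* The value of [g] at a chosen good point over [u], which by [good_inj] does not depend on the
   choice. The default 0 stays in [0,1]. *)
exists (fun u => if pselect (exists y, P u y) is left e
                 then g psi r (projT1 (cid e)) else 0).
split => [u|].
  case: pselect => [e|_]; last by rewrite lexx ler01.
  by case: cid => /= y [[Yy _] _]; exact: (mechanism01 r (mg Ppsi) Yy).
apply: filterS good_ae => y gy Yy; case: pselect => [e|[]]; last first.
  by exists y; split => //; exact: gy.
case: cid => /= y' [gy' e']; have := gy Yy => {}gy.
by apply/eqP; rewrite eq_le !good_inj.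
Qed.

End ignorability.

Theorem theorem3p1 (R : realType) (k d : nat)
  (Y : set (k.-tuple R)) (Theta : set (d.-tuple R))
  (Psi_t : Type) (Psi : set Psi_t)
  (f : d.-tuple R -> k.-tuple R -> R)
  (g : Psi_t -> k.-tuple bool -> k.-tuple R -> R)
  (disp : measure_display) (Omega : measurableType disp)
  (P : d.-tuple R -> Psi_t -> probability Omega R)
  (Yv : {mfun Omega >-> k.-tuple R}) (Rv : {mfun Omega >-> k.-tuple bool})
  (mY : measurable Y)
  (f_density : forall th, Theta th -> is_density Y (f th))
  (g_mechanism : forall psi, Psi psi -> is_mechanism Y (g psi))
  (selection_model : forall th psi, Theta th -> Psi psi ->
    has_joint_density (P th psi) Yv Rv Y (fun y r => f th y * g psi r y))
  (f_complete : complete_family Theta Y f) :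
  LIG Theta Psi Y f g <-> MAR Psi Y g.
Proof.
split; first exact: (LIG_MAR mY f_density g_mechanism f_complete).
exact: (MAR_LIG mY f_density g_mechanism).
Qed.
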